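(* Let $\Gamma$ be a finite group, let $X \subseteq \Gamma$ be a connection set, and let $G = \operatorname{Cay}(\Gamma, X)$. Suppose that $X$ is closed under conjugation, i.e. $\gamma x \gamma^{-1} \in X$ for all $x \in X$ and $\gamma \in \Gamma$. Then \[ \vartheta(G) = \max \Big\{ a_1 \;:\; a_\pi \geq 0 \text{ for each } \pi \in \hat\Gamma,\ \sum_{\pi \in \hat\Gamma} d_\pi^2 a_\pi = |\Gamma|,\ \sum_{\pi \in \hat\Gamma} d_\pi a_\pi \chi_\pi(x) = 0 \text{ for all } x \in X \Big\}, \] where the $a_\pi$ ($\pi \in \hat\Gamma$) are real numbers and $1 \in \hat\Gamma$ denotes the trivial representation.
   Context: A subset $X$ of a finite group $\Gamma$ with unit element $e$ is a connection set if $e \notin X$ and $x^{-1} \in X$ whenever $x \in X$. (It is not required that $X$ generates $\Gamma$.) The Cayley graph $\operatorname{Cay}(\Gamma, X)$ is the simple undirected graph with vertex set $\Gamma$ in which vertices $x$ and $y$ are adjacent if and only if $y^{-1}x \in X$. For a finite simple undirected graph $G = (V,E)$, the Lovász $\vartheta$-number is \[ \vartheta(G) = \max \Big\{ \sum_{u,v \in V} A(u,v) \;:\; A \in \mathcal{S}^V_{\succeq 0} \text{ real-valued},\ \operatorname{Tr}(A) = 1,\ A(u,v) = 0 \text{ for } \{u,v\} \in E \Big\}, \] where $\mathcal{S}^V_{\succeq 0}$ is the set of (complex, Hermitian) positive semidefinite matrices with rows and columns indexed by $V$; so the real-valued ones are the real symmetric positive semidefinite matrices. $\hat\Gamma$ is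 a fixed set of mutually inequivalent irreducible unitary representations $\pi \colon \Gamma \to \mathrm{U}(d_\pi)$ of $\Gamma$ containing exactly one representative of each unitary equivalence class; here $\mathrm{U}(d_\pi)$ is the group of unitary $d_\pi \times d_\pi$ complex matrices and $d_\pi$ is the degree of $\pi$. The character of $\pi$ is $\chi_\pi(\gamma) = \operatorname{Tr}(\pi(\gamma))$. *)

(* Defs.v *)
From mathcomp Require Import all_boot all_order all_algebra all_fingroup.
From mathcomp Require Import mxrepresentation.
From mathcomp Require Import complex.
From mathcomp Require Import boolp classical_sets reals.

Set Implicit Arguments.
Unset Strict Implicit.
Unset Printing Implicit Defensive.

Import Order.TTheory GRing.Theory Num.Theory.
Local Open Scope ring_scope.
Local Open Scope complex_scope.
Local Open Scope sesquilinear_scope.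

Definition is_max (R : realType) (S : set R) (m : R) : Prop :=
  S m /\ ubound S m.

Record sgraph := SGraph {
  vertex : finType;
  edge : rel vertex;
  edge_sym : symmetric edge;
  edge_irr : irreflexive edge }.

Definition connection_set (gT : finGroupType) (X : {set gT}) : Prop :=
  (1%g \notin X) /\ (forall x, x \in X -> (x^-1)%g \in X).

Definition cayley_rel (gT : finGroupType) (X : {set gT}) : rel gT :=
  fun x y => (y^-1 * x)%g \in X.

Lemma cayley_rel_sym (gT : finGroupType) (X : {set gT}) :
  connection_set X -> symmetric (cayley_rel X).
Proof.
move=> [_ XV] x y; rewrite /cayley_rel; apply/idP/idP => /XV;
  by rewrite invMg invgK.
Qed.

Lemma cayley_rel_irr (gT : finGroupType) (X : {set gT}) :
  connection_set X -> irreflexive (cayley_rel X).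
Proof. by move=> [/negPf X1 _] x; rewrite /cayley_rel mulVg. Qed.

Definition Cay (gT : finGroupType) (X : {set gT}) (hX : connection_set X) :
    sgraph :=
  SGraph (cayley_rel_sym hX) (cayley_rel_irr hX).

(* On R[i], 0 <= z means that z is real and nonnegative. *)
Definition psdmx (R : realType) (n : nat) (A : 'M[R[i]]_n) : Prop :=
  A \is hermsymmx /\ forall x : 'rV[R[i]]_n, 0 <= (x *m A *m x ^t*) 0 0.

(* Matrices indexed by a finType V are matrices of size #|V|, the entry (u, v)
   being read through enum_rank. *)
Definition theta_feasible (R : realType) (G : sgraph)
    (A : 'M[R]_#|vertex G|) : Prop :=
  [/\ psdmx (map_mx (real_complex R) A),
      \tr A = 1
    & forall u v : vertex G, edge u v -> A (enum_rank u) (enum_rank v) = 0].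

Definition theta_values (R : realType) (G : sgraph) : set R :=
  [set t | exists2 A : 'M[R]_#|vertex G|, theta_feasible A
         & t = \sum_(u : vertex G) \sum_(v : vertex G)
                 A (enum_rank u) (enum_rank v)]%classic.

(* A supremum over a set that is nonempty and compact when G has a vertex, and
   hence a maximum in that case. *)
Definition lovasz_theta (R : realType) (G : sgraph) : R :=
  sup (@theta_values R G).

Definition unitary_repr (R : realType) (gT : finGroupType) (n : nat)
    (rho : mx_representation R[i] [set: gT] n) : Prop :=
  forall g : gT, rho g \is unitarymx.

(* The equality of degrees is required because the rectangular matrices in
   unitarymx are only assumed to have orthonormal rows. *)
Definition unitary_equiv (R : realType) (gT : finGroupType) (n1 n2 : nat)
    (rho1 : mx_representation R[i] [set: gT] n1)
    (rho2 : mx_representation R[i] [set: gT] n2) : Prop :=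
  n1 = n2 /\
  exists2 U : 'M[R[i]]_(n1, n2), U \is unitarymx
        & forall g : gT, rho1 g *m U = U *m rho2 g.

Definition trivial_repr (R : realType) (gT : finGroupType) (n : nat)
    (rho : mx_representation R[i] [set: gT] n) : Prop :=
  n = 1%N /\ forall g : gT, rho g = 1%:M.

(* Exactly one representative of each unitary equivalence class of irreducible
   unitary representations; by dual_inj the family has no repetitions, so
   sums over the index type are sums over the set of representatives. *)
Record unitary_dual (R : realType) (gT : finGroupType) := UnitaryDual {
  dual_index :> finType;
  degree : dual_index -> nat;
  irrep : forall p : dual_index,
    mx_representation R[i] [set: gT] (degree p);
  dual_unitary : forall p, unitary_repr (irrep p);
  dual_irr : forall p, mx_irreducible (irrep p);
  dual_inj : forall p q, unitary_equiv (irrep p) (irrep q) -> p = q;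
  dual_complete : forall (n : nat)
      (rho : mx_representation R[i] [set: gT] n),
    unitary_repr rho -> mx_irreducible rho ->
    exists p, unitary_equiv rho (irrep p) }.

Definition chi (R : realType) (gT : finGroupType) (D : unitary_dual R gT)
    (p : D) (g : gT) : R[i] :=
  \tr (irrep p g).

(* Main.v *)
Require Import Defs.
From mathcomp Require Import all_boot all_order all_algebra all_fingroup.
From mathcomp Require Import mxrepresentation complex.
From mathcomp Require Import boolp classical_sets reals.
From mathcomp Require Import ring pgroup spectral.
From mathcomp Require Import topology function_spaces normedtype derive.

(** The two optimization problems have the same set of attainable values: each
    feasible matrix of the theta program yields a feasible family of the linear
    program with the same objective value, and conversely. The dictionary is
    Fourier analysis of the kernels on the group that are invariant under the
    maps (u, v) |-> (g u k, g v k). Since X is closed under conjugation, the maps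
    u |-> g u k are automorphisms of the graph, so averaging a feasible matrix
    over them would produce such a kernel.

    From a family a to a matrix (theta_of_lp): each kernel
    (u, v) |-> chi_p (v^-1 u) = tr (pi(v)^* pi(u)) is a Gram matrix, hence so is
    every combination of them with nonnegative coefficients. With coefficients
    d_p a_p / |G|^2 one gets the trace from the normalization of a, the vanishing
    on edges from the constraints indexed by X, and the sum of entries from the
    orthogonality of chi_p to the trivial character. The a_p need not agree on
    dual representations, so that kernel may be complex; its real part is again
    positive semidefinite and meets the same constraints.

    From a matrix A to a family (lp_of_theta): put
    d_p a_p = sum_(u, v) A(u, v) conj (chi_p (v^-1 u)), which is nonnegative as
    the pairing of two positive semidefinite matrices. The second orthogonality
    relation (chi_orthogonal2) turns sum_p d_p a_p chi_p(x) into a multiple of the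
    sum of A(u, v) over the pairs with v^-1 u conjugate to x; for x = 1 this is
    the trace, and for x in X it involves edges only, so it vanishes.

    The polytope of the linear program is nonempty and compact, so its objective
    attains a maximum (lp_attained), which by the dictionary is also the maximum
    of the theta program and therefore the supremum that defines theta.

    The character theory needed rests on the unitary form of Schur's lemma
    (schur_scalar, intertwiner_unitary_equiv) for the first orthogonality
    relations, and on complete reducibility of the regular representation
    (fourier_injective) for the second. *)

Set Implicit Arguments.
Unset Strict Implicit.
Unset Printing Implicit Defensive.

Import Order.TTheory GRing.Theory Num.Theory.
Import numFieldNormedType.Exports.
Local Open Scope complex_scope.
Local Open Scope sesquilinear_scope.
(* Opened after complex_scope, so that _ ^* is the conjugation of a numeric
   closed field and not the one of complex numbers. *)
Local Open Scope ring_scope.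

(** * Schur's lemma and Fourier analysis for unitary representations *)

Section UnitaryReps.
Variables (C : numClosedFieldType) (gT : finGroupType).
Local Notation rep n := (mx_representation C [set: gT] n).
Local Notation unitary rho := (forall g : gT, rho g \is unitarymx).

Lemma adjmxM m n p (A : 'M[C]_(m, n)) (B : 'M[C]_(n, p)) :
  (A *m B)^t* = B^t* *m A^t*.
Proof. by rewrite trmx_mul map_mxM. Qed.

Lemma reprTM n (rho : rep n) g h : rho (g * h)%g = rho g *m rho h.
Proof. by rewrite repr_mxM ?inE. Qed.

Lemma unitary_reprV n (rho : rep n) g :
  unitary rho -> rho (g^-1)%g = (rho g)^t*.
Proof. by move=> rhoU; rewrite repr_mxV ?inE // invmx_unitary. Qed.

Lemma irr_degree_gt0 n (rho : rep n) : mx_irreducible rho -> (0 < n)%N.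
Proof. by case/mx_irrP. Qed.

(** Over an algebraically closed field f has an eigenvalue c, and f - c is a
    singular intertwiner, hence zero. Naming the scalar by its trace is what the
    orthogonality relations use. *)
Lemma schur_scalar n (rho : rep n) (f : 'M[C]_n) :
    mx_irreducible rho -> (forall g, f *m rho g = rho g *m f) ->
  f = (\tr f / n%:R)%:M.
Proof.
move=> irr_rho cf; have n_gt0 := irr_degree_gt0 irr_rho.
have nz_n : n%:R != 0 :> C by rewrite pnatr_eq0 -lt0n.
have [c /eigenvalueP[v vf nz_v]] := eigenvalue_closed f n_gt0.
suff fE : f = c%:M by rewrite {1}fE fE mxtrace_scalar -(mulr_natr c) mulfK.
apply/eqP; rewrite -subr_eq0; apply: contraT => nz_fc.
have cent_fc : centgmx rho (f - c%:M).
  apply/centgmxP => g _.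
  by rewrite mulmxBl mulmxBr cf scalar_mxC.
have fc_unit := mx_Schur irr_rho cent_fc nz_fc.
case/negP: nz_v; apply/eqP; apply: (can_inj (mulmxK fc_unit)).
by rewrite mul0mx mulmxBr vf mul_mx_scalar subrr.
Qed.

Lemma trace_gram_ge0 m n (f : 'M[C]_(m, n)) : 0 <= \tr (f *m f^t*).
Proof.
apply: sumr_ge0 => i _; rewrite mxE; apply: sumr_ge0 => j _.
by rewrite !mxE mul_conjC_ge0.
Qed.

Lemma trace_gram_eq0 m n (f : 'M[C]_(m, n)) :
  (\tr (f *m f^t*) == 0) = (f == 0).
Proof.
apply/eqP/eqP => [tr0 | ->]; last by rewrite mul0mx mxtrace0.
have ge0 i j : 0 <= f i j * (f^t*) j i by rewrite !mxE mul_conjC_ge0.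
apply/matrixP => i j; rewrite [RHS]mxE; apply/eqP; rewrite -mul_conjC_eq0.
have ffi0 : (f *m f^t*) i i = 0.
  by apply: psumr_eq0P tr0 i isT => k _; rewrite mxE sumr_ge0.
move: ffi0; rewrite mxE => /psumr_eq0P-/(_ (fun k _ => ge0 i k) j isT).
by rewrite !mxE => ->.
Qed.

Lemma intertwiner_adj m n (rho : rep m) (sigma : rep n) (f : 'M[C]_(m, n)) :
    unitary rho -> unitary sigma -> (forall g, rho g *m f = f *m sigma g) ->
  forall g, sigma g *m f^t* = f^t* *m rho g.
Proof.
move=> rhoU sigmaU fE g.
have := fE (g^-1)%g; rewrite !unitary_reprV // => /(congr1 (fun A => A^t*)).
by rewrite !adjmxM !trmxCK.
Qed.

Lemma intertwiner_gram m n (rho : rep m) (sigma : rep n) (f : 'M[C]_(m, n)) :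
    unitary rho -> unitary sigma -> (forall g, rho g *m f = f *m sigma g) ->
  forall g, f *m f^t* *m rho g = rho g *m (f *m f^t*).
Proof.
move=> rhoU sigmaU fE g.
by rewrite -mulmxA -(intertwiner_adj rhoU sigmaU fE) !mulmxA fE.
Qed.

(** By Schur's lemma f f^* and f^* f are positive scalars, so f has full rank on
    both sides and becomes unitary once divided by the square root of the first
    scalar. Thus irreducible unitary representations that are equivalent at all
    are unitarily equivalent. *)
Lemma intertwiner_unitary_equiv m n (rho : rep m) (sigma : rep n)
    (f : 'M[C]_(m, n)) :
    unitary rho -> unitary sigma -> mx_irreducible rho -> mx_irreducible sigma ->
    f != 0 -> (forall g, rho g *m f = f *m sigma g) ->
  m = n /\ exists2 U : 'M[C]_(m, n), U \is unitarymx
                 & forall g, rho g *m U = U *m sigma g.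
Proof.
move=> rhoU sigmaU rho_irr sigma_irr nz_f fE.
have scal k l (r : rep k) (s : rep l) (h : 'M[C]_(k, l)) :
    unitary r -> unitary s -> mx_irreducible r -> h != 0 ->
    (forall g, r g *m h = h *m s g) ->
    exists2 c : C, 0 < c & h *m h^t* = c%:M.
  move=> rU sU r_irr nz_h hE; have k_gt0 := irr_degree_gt0 r_irr.
  exists (\tr (h *m h^t*) / k%:R).
    rewrite divr_gt0 ?ltr0n // lt_def trace_gram_eq0 nz_h.
    exact: trace_gram_ge0.
  by apply: schur_scalar r_irr _; apply: (intertwiner_gram rU sU hE).
have leq_deg k l (h : 'M[C]_(k, l)) c : 0 < c -> h *m h^t* = c%:M -> (k <= l)%N.
  move=> c_gt0 hh; have := mxrankM_maxl h (h^t*); rewrite hh -scalemx1.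
  rewrite mxrank_scale_nz ?gt_eqF // mxrank1 => /leq_trans; apply.
  exact: rank_leq_col.
have [c c_gt0 ffE] := scal _ _ _ _ _ rhoU sigmaU rho_irr nz_f fE.
have nz_ft : f^t* != 0.
  by apply: contraNneq nz_f => f0; rewrite -[f]trmxCK f0 trmx0 map_mx0.
have ftE := intertwiner_adj rhoU sigmaU fE.
have [c' c'_gt0 ffE'] := scal _ _ _ _ _ sigmaU rhoU sigma_irr nz_ft ftE.
split.
  by apply/eqP; rewrite eqn_leq (leq_deg _ _ _ _ c_gt0 ffE)
    (leq_deg _ _ _ _ c'_gt0 ffE').
exists ((sqrtC c)^-1 *: f) => [|g]; last by rewrite -scalemxAr fE scalemxAl.
have sqrt_real : ((sqrtC c)^-1)^* = (sqrtC c)^-1.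
  by rewrite conj_Creal // ger0_real // invr_ge0 sqrtC_ge0 ltW.
apply/unitarymxP; rewrite linearZ /= map_mxZ /= sqrt_real.
rewrite -scalemxAl -scalemxAr ffE scalerA -invfM -expr2 sqrtCK.
by rewrite scale_scalar_mx mulVf ?gt_eqF.
Qed.

Lemma intertwiner_average m n (rho : rep m) (sigma : rep n)
    (E : 'M[C]_(m, n)) h :
    unitary sigma ->
    rho h *m (\sum_g rho g *m E *m (sigma g)^t*) =
  (\sum_g rho g *m E *m (sigma g)^t*) *m sigma h.
Proof.
move=> sigmaU; rewrite mulmx_sumr mulmx_suml.
rewrite [RHS](reindex_inj (mulgI h)) /=; apply: eq_bigr => g _.
rewrite -!unitary_reprV // -[in RHS]mulmxA -reprTM invMg mulgKV reprTM.
by rewrite !mulmxA.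
Qed.

(** This reads a product of matrix coefficients as an entry of the averaged
    intertwiner, with E an elementary matrix. *)
Lemma delta_conj_entry m n (A : 'M[C]_m) (B : 'M[C]_n) i j k l :
  (A *m delta_mx j l *m B^t*) i k = A i j * (B k l)^*.
Proof.
rewrite mxE (bigD1 l) //= big1 ?addr0 => [|l' ne_l'l].
  rewrite mxE (bigD1 j) //= big1 ?addr0 ?mxE ?eqxx ?mulr1 // => j' ne_j'j.
  by rewrite !mxE (negPf ne_j'j) mulr0.
rewrite mxE big1 ?mul0r // => j' _.
by rewrite !mxE (negPf ne_l'l) andbF mulr0.
Qed.

Lemma coef_orthogonal m n (rho : rep m) (sigma : rep n) i j k l :
    unitary rho -> unitary sigma -> mx_irreducible rho -> mx_irreducible sigma ->
    ~ (m = n /\ exists2 U : 'M[C]_(m, n), U \is unitarymx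
                 & forall g, rho g *m U = U *m sigma g) ->
  \sum_g rho g i j * (sigma g k l)^* = 0.
Proof.
move=> rhoU sigmaU rho_irr sigma_irr neq.
pose F := \sum_g rho g *m delta_mx j l *m (sigma g)^t*.
have F0 : F = 0.
  apply: contra_notP neq => /eqP nz_F.
  apply: (intertwiner_unitary_equiv (f := F)) => // g.
  exact: intertwiner_average.
transitivity (F i k); last by rewrite F0 mxE.
by rewrite summxE; apply: eq_bigr => g _; rewrite delta_conj_entry.
Qed.

Lemma coef_orthonormal n (rho : rep n) i j k l :
    unitary rho -> mx_irreducible rho ->
  \sum_g rho g i j * (rho g k l)^* =
    ((i == k) && (j == l))%:R * (#|gT|%:R / n%:R).
Proof.
move=> rhoU rho_irr.
pose F := \sum_g rho g *m delta_mx j l *m (rho g)^t*.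
have trF : \tr F = (j == l)%:R * #|gT|%:R.
  rewrite raddf_sum /= (eq_bigr (fun=> (j == l)%:R)) => [|g _].
    by rewrite sumr_const -[LHS]mulr_natr.
  rewrite mxtrace_mulC mulmxA -unitary_reprV // -reprTM mulVg repr_mx1 mul1mx.
  rewrite /mxtrace (bigD1 j) //= big1 ?mxE ?eqxx ?addr0 ?(eq_sym l) // => j' ne_j'.
  by rewrite mxE (negPf ne_j').
have FE : F = (\tr F / n%:R)%:M.
  by apply: schur_scalar rho_irr _ => g; rewrite intertwiner_average.
transitivity (F i k).
  by rewrite summxE; apply: eq_bigr => g _; rewrite delta_conj_entry.
rewrite FE trF mxE.
by case: (i == k); case: (j == l); rewrite ?mulr1n ?mulr0n ?mul1r ?mul0r.
Qed.

(** Gram-Schmidt gives an orthonormal basis B of U, and B rho(g) B^* is then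
    unitary because B^* B acts as the identity on U. *)
Lemma unitary_simple_submod n (rho : rep n) (U : 'M[C]_n) :
    unitary rho -> mxsimple rho U ->
  exists k (sigma : rep k), [/\ unitary sigma, mx_irreducible sigma &
    exists2 B : 'M[C]_(k, n), (B :=: U)%MS
      & forall g, B *m rho g = sigma g *m B].
Proof.
move=> rhoU simU; have [modU _ _] := simU.
pose B := schmidt (row_base U).
have B_U : B \is unitarymx by rewrite schmidt_unitarymx // rank_leq_col.
have BE : (B :=: U)%MS.
  apply: eqmx_trans (eq_row_base U).
  by apply: eqmx_schmidt_free; exact: row_base_free.
pose s g := B *m rho g *m B^t*.
have sB g : s g *m B = B *m rho g.
  have /submxP[A AE] : (B *m rho g <= B)%MS.
    by rewrite BE (eqmxMr _ BE) (mxmoduleP modU) ?inE.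
  by rewrite /s AE -(mulmxA A) (unitarymxP B_U) mulmx1.
have s_repr : mx_repr [set: gT] s.
  split=> [|g h _ _]; first by rewrite /s repr_mx1 mulmx1 (unitarymxP B_U).
  by rewrite [s h]/s !mulmxA sB [s _]/s reprTM !mulmxA.
pose sigma := MxRepresentation s_repr.
exists (\rank U), sigma; split=> [g| |].
- have sV : (s g)^t* = B *m (rho g)^t* *m B^t*.
    by rewrite /s !adjmxM trmxCK mulmxA.
  apply/unitarymxP; rewrite /= sV !mulmxA sB -(mulmxA B).
  by rewrite (unitarymxP (rhoU g)) mulmx1 (unitarymxP B_U).
- apply: mx_rsim_irr ((submod_mx_irr modU).2 simU).
  set V := val_submod (U := U) 1%:M.
  have VE : V *m B^t* *m B = V.
    have /submxP[A AE] : (V <= B)%MS by rewrite BE val_submod1.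
    by rewrite AE -(mulmxA A) (unitarymxP B_U) mulmx1.
  exists (V *m B^t*) => [//||g _].
    rewrite /row_free eqn_leq rank_leq_row /=.
    apply: leq_trans (mxrankM_maxl (V *m B^t*) B).
    by rewrite VE /V val_submod1.
  have := val_submodJ modU 1%:M (finset.in_setT g).
  rewrite mul1mx val_submodE -/V => VJ.
  by rewrite mulmxA [X in X *m _]VJ [RHS]/= /s !mulmxA VE.
by exists B.
Qed.

(** The regular representation is unitary and, by Maschke's theorem, a sum of
    irreducible unitary ones, so phi acts as zero on it; but the operators of the
    regular representation are linearly independent. *)
Lemma fourier_injective (phi : gT -> C) :
    (forall n (rho : rep n), unitary rho -> mx_irreducible rho ->
       \sum_g phi g *: rho g = 0) ->
  forall g, phi g = 0.
Proof.
move=> phi0.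
pose reg := regular_repr C [set: gT]%G.
have regU : unitary reg.
  move=> g; apply/row_unitarymxP => i j; rewrite dotmxE !rowK.
  rewrite trmx_delta map_delta_mx mul_delta_mx_cond.
  rewrite [delta_mx 0 0]mx11_scalar !mxE /=.
  rewrite (can_in_eq (gring_indexK (G := [set: gT])))  ?inE //.
  rewrite (inj_eq (mulIg g)) (inj_eq enum_val_inj).
  by rewrite mulmxnE mxE eqxx.
pose Phi := \sum_g phi g *: reg g.
have Phi0 : Phi = 0.
  (* Semisimplicity is asserted under the classical modality, which can be
     discharged on a boolean goal. *)
  apply/eqP; apply/idPn; apply/negP; rewrite negbK.
  have red : mx_completely_reducible reg 1%:M.
    apply: mx_Maschke_pchar; apply/pgroupP=> p p_prime _.
    by rewrite inE /= Num.Theory.pchar_num.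
  have := mx_reducible_semisimple (mxmodule1 reg) red.
  apply => -[I U W simU sumU _].
  suff : (1%:M <= kermx Phi)%MS by move/sub_kermxP; rewrite mul1mx => ->.
  rewrite -sumU; apply/sumsmx_subP => i _; apply/sub_kermxP.
  have [k [sigma [sigmaU sigma_irr [B BE sB]]]] :=
    unitary_simple_submod regU (simU i).
  have /submxP[A ->] : (U i <= B)%MS by rewrite BE.
  rewrite -mulmxA; suff -> : B *m Phi = 0 by rewrite mulmx0.
  transitivity ((\sum_g phi g *: sigma g) *m B); last by rewrite phi0 ?mul0mx.
  rewrite mulmx_sumr mulmx_suml; apply: eq_bigr => g _.
  by rewrite -scalemxAr sB scalemxAl.
move=> g.
have := congr1 (gring_proj (G := [set: gT]) g) Phi0.
rewrite linear0 linear_sum (bigD1 g) //= linearZ /= gring_projE ?inE // eqxx.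
rewrite big1 ?addr0 => [|h ne_hg].
  by move/matrixP/(_ 0 0); rewrite !mxE mulr1.
by rewrite linearZ /= gring_projE ?inE // eq_sym (negPf ne_hg) scaler0.
Qed.
End UnitaryReps.

(** * Orthogonality relations for characters *)

Section Characters.
Variables (R : realType) (gT : finGroupType) (D : unitary_dual R gT).
Local Notation C := R[i].

Lemma degree_gt0 (p : D) : (0 < degree p)%N.
Proof. exact: irr_degree_gt0 (dual_irr p). Qed.

Lemma chi1 (p : D) : chi p 1%g = (degree p)%:R.
Proof. by rewrite /chi repr_mx1 mxtrace1. Qed.

Lemma chiV (p : D) g : chi p g^-1%g = (chi p g)^*.
Proof.
rewrite /chi unitary_reprV; last exact: dual_unitary.
by rewrite trace_map_mx mxtrace_tr.
Qed.

Lemma chiJ (p : D) g h : chi p (h * g * h^-1)%g = chi p g.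
Proof. by rewrite /chi reprTM mxtrace_mulC -reprTM mulgA mulVg mul1g. Qed.

Lemma chi_class (p : D) g h : g \in (h ^: [set: gT])%g -> chi p g = chi p h.
Proof.
by case/imsetP=> x _ ->; rewrite conjgE -(chiJ p h x^-1) invgK mulgA.
Qed.

Lemma chi_orthogonal (p q : D) :
  \sum_g chi p g * (chi q g)^* = (p == q)%:R * #|gT|%:R.
Proof.
transitivity (\sum_i \sum_k \sum_g irrep p g i i * (irrep q g k k)^*).
  rewrite (eq_bigr _ (fun i _ => exchange_big _ _ _ _ _ _)) /= exchange_big /=.
  apply: eq_bigr => g _; by rewrite /chi rmorph_sum /= big_distrlr.
have [<-{q} | ne_pq] := eqVneq p q.
  rewrite mul1r.
  rewrite (eq_bigr (fun=> #|gT|%:R / (degree p)%:R)) => [|i _].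
    rewrite sumr_const card_ord -[LHS]mulr_natr mulfVK //.
    by rewrite pnatr_eq0 -lt0n degree_gt0.
  under eq_bigr => k _ do
    rewrite (coef_orthonormal i i k k (dual_unitary p) (dual_irr p)) andbb.
  rewrite (bigD1 i) //= eqxx mul1r big1 ?addr0 // => k ne_ki.
  by rewrite eq_sym (negPf ne_ki) mul0r.
rewrite mul0r big1 // => i _; rewrite big1 // => k _.
apply: coef_orthogonal (dual_unitary p) (dual_unitary q)
  (dual_irr p) (dual_irr q) _.
by move/dual_inj/eqP; rewrite (negPf ne_pq).
Qed.

(** The Fourier coefficient of a class function at an irreducible rho commutes
    with rho, so it is a scalar, and its trace is the pairing with a character of
    the dual. *)
Lemma class_fun_eq0 (phi : gT -> C) :
    (forall g h, phi (h * g * h^-1)%g = phi g) ->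
    (forall p : D, \sum_g phi g * chi p g = 0) ->
  forall g, phi g = 0.
Proof.
move=> phiJ phi_chi0; apply: fourier_injective => n rho rhoU rho_irr.
have [p [En [U U_unitary rhoUE]]] := dual_complete D rhoU rho_irr; subst n.
have tr_rho g : \tr (rho g) = chi p g.
  rewrite -[rho g](mulmxtVK _ U_unitary) rhoUE mxtrace_mulC mulmxA.
  by rewrite (mulmx1C (unitarymxP U_unitary)) mul1mx.
rewrite (schur_scalar (f := \sum_g phi g *: rho g) rho_irr) => [|h].
  rewrite raddf_sum /= [X in X / _](_ : _ = 0) ?mul0r ?raddf0 //.
  rewrite -[RHS](phi_chi0 p).
  by apply: eq_bigr => g _; rewrite mxtraceZ tr_rho.
rewrite mulmx_suml mulmx_sumr (reindex_inj (conjg_inj h^-1%g)) /=.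
apply: eq_bigr => g _; rewrite -scalemxAl -scalemxAr -!reprTM.
by rewrite conjgE invgK mulgA phiJ mulgKV.
Qed.

(** The indicator of the conjugacy class of h and the right candidate for its
    expansion in characters have the same pairing with each character, by the
    first orthogonality relations; class_fun_eq0 then identifies them. *)
Lemma chi_orthogonal2 (g h : gT) :
  \sum_(p : D) chi p h * (chi p g)^* =
    (g \in h ^: [set: gT])%g%:R * (#|gT|%:R / #|(h ^: [set: gT])%g|%:R).
Proof.
set K := (h ^: _)%g.
have nzK : #|K|%:R != 0 :> C.
  by rewrite pnatr_eq0 -lt0n; apply/card_gt0P; exists h; apply: class_refl.
have nzG : #|gT|%:R != 0 :> C.
  by rewrite pnatr_eq0 -lt0n; apply/card_gt0P; exists h.
pose c : C := #|K|%:R / #|gT|%:R.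
have nzc : c != 0 by rewrite mulf_neq0 ?invr_eq0.
suff /(_ g)/eqP : forall g,
    (g \in K)%:R - c * \sum_(p : D) chi p h * (chi p g)^* = 0.
  by rewrite subr_eq0 => /eqP ->; rewrite -invf_div -/c mulrAC mulfV ?mul1r.
apply: class_fun_eq0 => [{}g x | q].
  congr (_ - c * _); last by apply: eq_bigr => p _; rewrite chiJ.
  have cgx : (x * g * x^-1 \in g ^: [set: gT])%g.
    by apply/imsetP; exists x^-1%g; rewrite ?inE // conjgE invgK mulgA.
  by rewrite (class_transl _ cgx).
under eq_bigr => g' _ do rewrite mulrBl -mulrA.
rewrite sumrB.
have -> : \sum_g' (g' \in K)%:R * chi q g' = #|K|%:R * chi q h.
  rewrite (bigID (mem K)) /= [X in _ + X]big1 => [|g' /negPf ->]; last first.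
    by rewrite mul0r.
  rewrite addr0 (eq_bigr (fun=> chi q h)) => [|g' Kg']; last first.
    by rewrite Kg' mul1r (chi_class _ Kg').
  by rewrite sumr_const mulr_natl.
rewrite -mulr_sumr.
under eq_bigr => g' _ do rewrite mulr_suml.
rewrite exchange_big /=.
under eq_bigr => p _ do
  (under eq_bigr => g' _ do rewrite -mulrA [_^* * _]mulrC;
   rewrite -mulr_sumr chi_orthogonal).
rewrite (bigD1 q) //= big1 => [|p ne_pq]; last first.
  by rewrite eq_sym (negPf ne_pq) mul0r mulr0.
by rewrite eqxx mul1r addr0 /c mulrCA mulrC -mulrA mulVf // mulr1 mulrC subrr.
Qed.
End Characters.

(** * Attainment of the maximum in a linear program *)

Section LinearProgram.
Import ArrowAsProduct.
Local Open Scope classical_set_scope.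

Lemma continuous_linear_form (R : realType) (I : finType) (w : I -> R) :
  continuous (fun a : I -> R => \sum_i w i * a i).
Proof.
apply: (@continuous_big _ _ +%R 0).
  exact: add_continuous.
move=> i _ a.
have pc : (fun x : I -> R => x i) x @[x --> a] --> a i.
  exact: (@proj_continuous I (fun=> R) i a).
exact: (continuous_comp pc (@mulrl_continuous _ (w i) _)).
Qed.

(** Positivity of the weights w confines the feasible points to the box of the
    [0, N / w i], which is compact for the product topology; the remaining
    constraints are closed. *)
Lemma linear_program_max (R : realType) (I : finType) (K : Type)
    (w : I -> R) (N : R) (c : K -> I -> R) (i0 : I) :
    (forall i, 0 < w i) ->
  let S := [set a : I -> R | [/\ forall i, 0 <= a i, \sum_i w i * a i = N
              & forall k, \sum_i c k i * a i = 0]] in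
  S !=set0 -> exists2 a, S a & forall b, S b -> b i0 <= a i0.
Proof.
move=> w_gt0 S S0.
have closed_level u b : closed [set a : I -> R | \sum_i u i * a i = b].
  apply: (@preimage_closed _ _ (fun a : I -> R => \sum_i u i * a i) [set b]);
    last exact: closed_eq.
  by move=> a _; exact: continuous_linear_form.
have S_compact : compact S.
  have -> : S = [set a : I -> R | forall i, `[0, N / w i] (a i)] `&`
     ([set a : I -> R | \sum_i w i * a i = N] `&`
       \bigcap_k [set a : I -> R | \sum_i c k i * a i = 0]).
    apply/seteqP; split=> a /=.
      move=> [a_ge0 aN ac]; split; last by split=> // k _; exact: ac.
      move=> i; rewrite in_itv /= a_ge0 /= ler_pdivlMr // mulrC -aN.
      rewrite (bigD1 i) //=.
      by rewrite lerDl sumr_ge0 // => j _; rewrite mulr_ge0 // ltW.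
    move=> [aI [aN ac]]; split=> // [i|k]; last exact: ac.
    by have := aI i; rewrite in_itv /= => /andP[].
  apply: compact_closedI.
    apply: (@tychonoff I (fun=> R) (fun i => `[0, N / w i])) => i.
    exact: segment_compact.
  by apply: closedI => //; apply: closed_bigI => k _; exact: closed_level.
have [|a aS a_max] :=
    @compact_EVT_max _ R (fun a : I -> R => a i0) S S0 S_compact.
  apply: continuous_subspaceT => a.
  exact: (@proj_continuous I (fun=> R) i0 a).
exists a; first by rewrite -inE.
by move=> b bS; apply: a_max; rewrite inE.
Qed.

End LinearProgram.

(** * Positive semidefinite kernels on a finite type *)

Section PsdKernels.
Variable R : realType.
Local Notation C := R[i].

Lemma conj_real_complex (x : R) : (x%:C)^* = x%:C.
Proof. exact: conjc_real. Qed.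

Lemma quadratic_formE n (A : 'M[C]_n) (x : 'rV[C]_n) :
  (x *m A *m x^t*) 0 0 = \sum_i \sum_j x 0 i * A i j * (x 0 j)^*.
Proof.
rewrite mxE exchange_big /=; apply: eq_bigr => j _.
by rewrite !mxE mulr_suml; apply: eq_bigr => i _.
Qed.

Lemma psdmx_form_ge0 (V : finType) (A : 'M[C]_#|V|) (f : V -> C) :
    psdmx A ->
  0 <= \sum_u \sum_v f u * A (enum_rank u) (enum_rank v) * (f v)^*.
Proof.
case=> _ /(_ (\row_i f (enum_val i))); rewrite quadratic_formE.
congr (0 <= _).
rewrite (reindex enum_rank) /=; last exact/onW_bij/enum_rank_bij.
apply: eq_bigr => u _.
rewrite (reindex enum_rank) /=; last exact/onW_bij/enum_rank_bij.
by apply: eq_bigr => v _; rewrite !mxE !enum_rankK.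
Qed.

Lemma real_sym_psdmx (V : finType) (F : V -> V -> R) :
    (forall u v, F u v = F v u) ->
    (forall f : V -> C, 0 <= \sum_u \sum_v f u * (F u v)%:C * (f v)^*) ->
  psdmx (map_mx (real_complex R)
           (\matrix_(i, j < #|V|) F (enum_val i) (enum_val j))).
Proof.
move=> F_sym F_ge0; split=> [|x].
  apply/is_hermitianmxP; rewrite expr0 scale1r; apply/matrixP=> i j.
  by rewrite !mxE F_sym; apply/esym; exact: conj_real_complex.
rewrite quadratic_formE; have := F_ge0 (fun u => x 0 (enum_rank u)).
congr (0 <= _).
rewrite [RHS](reindex enum_rank) /=; last exact/onW_bij/enum_rank_bij.
apply: eq_bigr => u _.
rewrite [RHS](reindex enum_rank) /=; last exact/onW_bij/enum_rank_bij.
by apply: eq_bigr => v _; rewrite !mxE !enum_rankK.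
Qed.
End PsdKernels.

(** * The theta program and the linear program of a Cayley graph *)

Section ThetaCayley.
Variables (R : realType) (gT : finGroupType) (D : unitary_dual R gT).
Local Notation C := R[i].

Lemma chi_quotientE (p : D) u v :
  chi p (v^-1 * u)%g = \sum_i \sum_j (irrep p v i j)^* * irrep p u i j.
Proof.
rewrite /chi reprTM unitary_reprV; last exact: dual_unitary.
rewrite exchange_big /=; apply: eq_bigr => j _; rewrite mxE.
by apply: eq_bigr => i _; rewrite !mxE.
Qed.

(** The form is the squared Frobenius norm of sum_u f(u) pi(u). *)
Lemma chi_form_ge0 (p : D) (f : gT -> C) :
  0 <= \sum_u \sum_v f u * chi p (v^-1 * u)%g * (f v)^*.
Proof.
rewrite [X in 0 <= X](_ : _ = \sum_i \sum_j `|\sum_u f u * irrep p u i j| ^+ 2).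
  by apply: sumr_ge0 => i _; apply: sumr_ge0 => j _; rewrite exprn_ge0.
transitivity (\sum_u \sum_v \sum_i \sum_j
    (f u * irrep p u i j) * (f v * irrep p v i j)^*).
  apply: eq_bigr => u _; apply: eq_bigr => v _; rewrite chi_quotientE.
  rewrite mulr_sumr mulr_suml; apply: eq_bigr => i _.
  rewrite mulr_sumr mulr_suml; apply: eq_bigr => j _.
  by rewrite rmorphM /=; ring.
under eq_bigr => u _ do rewrite exchange_big; rewrite exchange_big /=.
apply: eq_bigr => i _.
under eq_bigr => u _ do rewrite exchange_big; rewrite exchange_big /=.
apply: eq_bigr => j _.
by rewrite normCK rmorph_sum big_distrlr.
Qed.

(** The sum splits into the values of the quadratic form of A at the vectors of
    conjugated matrix coefficients u |-> conj (pi(u)_ij). *)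
Lemma psd_character_sum_ge0 (p : D) (A : 'M[C]_#|gT|) :
    psdmx A ->
  0 <= \sum_u \sum_v A (enum_rank u) (enum_rank v) * (chi p (v^-1 * u)%g)^*.
Proof.
move=> A_psd.
rewrite [X in 0 <= X](_ : _ = \sum_i \sum_j \sum_u \sum_v
    (irrep p u i j)^* * A (enum_rank u) (enum_rank v) * ((irrep p v i j)^*)^*).
  apply: sumr_ge0 => i _; apply: sumr_ge0 => j _.
  exact: (psdmx_form_ge0 (fun u => (irrep p u i j)^*)).
under [RHS]eq_bigr => i _ do rewrite exchange_big.
rewrite [RHS]exchange_big; apply: eq_bigr => u _.
under [RHS]eq_bigr => i _ do rewrite exchange_big.
rewrite [RHS]exchange_big; apply: eq_bigr => v _.
rewrite chi_quotientE rmorph_sum mulr_sumr; apply: eq_bigr => i _.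
rewrite rmorph_sum mulr_sumr; apply: eq_bigr => j _.
by rewrite rmorphM /=; ring.
Qed.

Section Graph.
Variables (X : {set gT}) (hX : connection_set X).
Hypothesis hconj : forall x g : gT, x \in X -> (g * x * g^-1)%g \in X.
Variables (one : D) (hone : trivial_repr (irrep one)).

Definition lp_feasible (a : D -> R) : Prop :=
  [/\ forall p : D, 0 <= a p,
      \sum_(p : D) (degree p)%:R ^+ 2 * a p = #|gT|%:R
    & forall x : gT, x \in X ->
        \sum_(p : D) (degree p)%:R * (a p)%:C * chi p x = 0].

Lemma degree_one : degree one = 1%N. Proof. by case: hone. Qed.

Lemma chi_one g : chi one g = 1.
Proof. by case: hone => d1 h; rewrite /chi h mxtrace1 d1. Qed.

Lemma sum_chi (p : D) : \sum_g chi p g = (p == one)%:R * #|gT|%:R.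
Proof.
rewrite -chi_orthogonal; apply: eq_bigr => g _.
by rewrite chi_one rmorph1 mulr1.
Qed.

(** The matrix is the real part of the kernel h (v^-1 u) with
    h = |G|^-2 sum_p d_p a_p chi_p. *)
Lemma theta_of_lp a : lp_feasible a -> theta_values (Cay hX) (a one).
Proof.
move=> [a_ge0 a_norm a_X].
have nzG : #|gT|%:R != 0 :> R.
  by rewrite pnatr_eq0 -lt0n; apply/card_gt0P; exists 1%g.
have nzGC : #|gT|%:R != 0 :> C.
  by rewrite pnatr_eq0 -lt0n; apply/card_gt0P; exists 1%g.
have natC n : (n%:R : R)%:C = n%:R :> C by rewrite rmorph_nat.
pose h g : C := #|gT|%:R ^- 2 *
  \sum_(p : D) (degree p)%:R * (a p)%:C * chi p g.
have hV g : h g^-1%g = (h g)^*.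
  rewrite /h rmorphM rmorph_sum /= fmorphV rmorphXn rmorph_nat /=; congr (_ * _).
  apply: eq_bigr => p _; rewrite (chiV p g) !rmorphM rmorph_nat.
  by congr (_ * _ * _); apply/esym; exact: conj_real_complex.
pose f g := complex.Re (h g).
have fE g : (f g)%:C = (h g + h g^-1%g) / 2%:R by rewrite ReJ_add hV.
pose F u v := f (v^-1 * u)%g.
have h_psd (c : gT -> C) : 0 <= \sum_u \sum_v c u * h (v^-1 * u)%g * (c v)^*.
  rewrite [X in 0 <= X](_ : _ =
      #|gT|%:R ^- 2 * \sum_(p : D) (degree p)%:R * (a p)%:C *
        \sum_u \sum_v c u * chi p (v^-1 * u)%g * (c v)^*).
    rewrite mulr_ge0 ?invr_ge0 ?exprn_ge0 ?ler0n //; apply: sumr_ge0 => p _.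
    by rewrite mulr_ge0 ?chi_form_ge0 // mulr_ge0 ?ler0n // ler0c.
  rewrite mulr_sumr.
  under [RHS]eq_bigr => p _ do rewrite !mulr_sumr.
  rewrite [RHS]exchange_big; apply: eq_bigr => u _.
  under [RHS]eq_bigr => p _ do rewrite !mulr_sumr.
  rewrite [RHS]exchange_big; apply: eq_bigr => v _.
  rewrite /h !mulr_sumr mulr_suml; apply: eq_bigr => p _.
  by ring.
have h1 : h 1%g = #|gT|%:R^-1.
  have -> : h 1%g = #|gT|%:R ^- 2 * (\sum_(p : D) (degree p)%:R ^+ 2 * a p)%:C.
    rewrite rmorph_sum; congr (_ * _); apply: eq_bigr => p _.
    by rewrite chi1 rmorphM rmorphXn rmorph_nat expr2 mulrAC.
  by rewrite a_norm natC expr2 invfM mulfVK.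
have f1 : f 1%g = #|gT|%:R^-1.
  by rewrite /f h1 -natC -fmorphV.
have sum_h : \sum_g h g = #|gT|%:R^-1 * (a one)%:C.
  rewrite -mulr_sumr exchange_big /= (bigD1 one) //= -mulr_sumr sum_chi eqxx.
  rewrite big1 => [|p ne_p]; last first.
    by rewrite -mulr_sumr sum_chi (negPf ne_p) mul0r mulr0.
  rewrite addr0 !mul1r degree_one mul1r expr2 invfM [_ * #|gT|%:R]mulrC mulrA.
  by rewrite mulfVK.
have sum_f : \sum_g f g = #|gT|%:R^-1 * a one.
  apply: (@complexI R); rewrite rmorphM fmorphV /= natC rmorph_sum /=.
  under eq_bigr => g _ do rewrite fE.
  rewrite -mulr_suml big_split /= [X in _ + X](_ : _ = \sum_g h g).
    by rewrite sum_h -mulr2n -[X in X / _]mulr_natr mulfK // pnatr_eq0.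
  by rewrite [RHS](reindex_inj invg_inj).
have edgeF x : x \in X -> f x = 0.
  by move=> Xx; rewrite /f /h a_X // mulr0.
exists (\matrix_(i, j < #|gT|) F (enum_val i) (enum_val j)).
  split.
  - apply: real_sym_psdmx => [u v|c].
      apply: (@complexI R); rewrite /F !fE !invMg !invgK addrC //.
    (* Exchanging u and v in the part with h (u^-1 v) turns it into the form
       of h at the conjugate of c. *)
    rewrite [X in 0 <= X](_ : _ =
      (\sum_u \sum_v c u * h (v^-1 * u)%g * (c v)^* +
       \sum_u \sum_v (c u)^* * h (v^-1 * u)%g * ((c v)^*)^*) / 2%:R).
      by rewrite divr_ge0 ?ler0n // addr_ge0 ?h_psd.
    rewrite [X in _ + X]exchange_big /= -big_split mulr_suml /=.
    apply: eq_bigr => u _; rewrite -big_split mulr_suml /=.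
    apply: eq_bigr => v _; rewrite /F fE invMg invgK conjCK.
    by ring.
  - rewrite /mxtrace (eq_bigr (fun=> #|gT|%:R^-1)) => [|i _]; last first.
      by rewrite mxE /F mulVg f1.
    by rewrite sumr_const card_ord -[LHS]mulr_natl mulfV.
  - by move=> u v uv; rewrite mxE !enum_rankK; apply: edgeF.
transitivity (\sum_(u : gT) \sum_g f g); last first.
  apply: eq_bigr => u _.
  rewrite (reindex_inj invg_inj) (reindex_inj (mulgI u^-1%g)) /=.
  by apply: eq_bigr => v _; rewrite mxE !enum_rankK /F invMg invgK.
by rewrite sum_f sumr_const -[RHS]mulr_natl mulVKf.
Qed.

(** The kernel chi_p (v^-1 u) is invariant under (u, v) |-> (g u k, g v k), so
    pairing A with it gives the Fourier coefficients of the average of A under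
    these maps. *)
Lemma lp_of_theta t :
  theta_values (Cay hX) t -> exists2 a, lp_feasible a & t = a one.
Proof.
move=> [A [A_psd A_tr A_edge] ->].
pose B (u v : gT) : C := (A (enum_rank u) (enum_rank v))%:C.
pose T (p : D) : C := \sum_u \sum_v B u v * (chi p (v^-1 * u)%g)^*.
have T_ge0 p : 0 <= T p.
  have := psd_character_sum_ge0 p A_psd.
  by congr (0 <= _); apply: eq_bigr => u _; apply: eq_bigr => v _; rewrite mxE.
have nz_deg (p : D) : (degree p)%:R != 0 :> C.
  by rewrite pnatr_eq0 -lt0n degree_gt0.
pose a (p : D) : R := complex.Re (T p) / (degree p)%:R.
have aE p : (degree p)%:R * (a p)%:C = T p :> C.
  rewrite /a rmorphM fmorphV /= rmorph_nat mulrC mulfVK //.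
  by apply: RRe_real; apply: ger0_real.
have T_sum x : \sum_p T p * chi p x =
    \sum_u \sum_v B u v *
      ((v^-1 * u \in x ^: [set: gT])%g%:R *
         (#|gT|%:R / #|(x ^: [set: gT])%g|%:R)).
  under eq_bigr => p _ do rewrite mulr_suml.
  rewrite exchange_big; apply: eq_bigr => u _.
  under eq_bigr => p _ do rewrite mulr_suml.
  rewrite exchange_big; apply: eq_bigr => v _.
  rewrite -(chi_orthogonal2 D) mulr_sumr; apply: eq_bigr => p _.
  by rewrite -mulrA [_^* * _]mulrC.
exists a.
  split.
  - move=> p; rewrite -ler0c -(pmulr_rge0 _ (_ : 0 < (degree p)%:R)) ?aE //.
    by rewrite ltr0n degree_gt0.
  - apply: (@complexI R); rewrite rmorph_sum rmorph_nat /=.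
    transitivity (\sum_p T p * chi p 1%g).
      apply: eq_bigr => p _; rewrite -aE chi1 rmorphM rmorphXn rmorph_nat /=.
      by ring.
    rewrite T_sum class1G cards1 divr1.
    transitivity (\sum_u B u u * #|gT|%:R).
      apply: eq_bigr => u _; rewrite (bigD1 u) //= mulVg set11 mul1r.
      rewrite big1 ?addr0 // => v ne_vu.
      rewrite inE -eq_mulVg1 (negPf ne_vu) mul0r mulr0 //.
    rewrite -mulr_suml -rmorph_sum /=.
    have -> : \sum_u A (enum_rank u) (enum_rank u) = 1.
      rewrite -A_tr /mxtrace [RHS](reindex enum_rank) //=.
      exact/onW_bij/enum_rank_bij.
    by rewrite rmorph1 mul1r.
  - move=> x Xx; under eq_bigr => p _ do rewrite aE.
    rewrite T_sum big1 // => u _; rewrite big1 // => v _.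
    have [vuK|] := boolP (_ \in _); last by rewrite mul0r mulr0.
    rewrite /B A_edge ?rmorph0 ?mul0r //= /cayley_rel.
    case/imsetP: vuK => g _ ->.
    by rewrite conjgE -[X in (_ * (_ * X))%g]invgK mulgA; apply: hconj.
apply: (@complexI R).
rewrite -[RHS]mul1r -[X in X * _](_ : (degree one)%:R = 1 :> C).
  rewrite aE rmorph_sum; apply: eq_bigr => u _.
  rewrite rmorph_sum; apply: eq_bigr => v _.
  by rewrite chi_one rmorph1 mulr1.
by rewrite degree_one.
Qed.

(** These are the Fourier coefficients of the scalar matrix |G|^-1; the
    constraints are the decomposition of the regular character. *)
Lemma lp_feasible_cst1 : lp_feasible (fun=> 1).
Proof.
have sum_deg x : \sum_(p : D) (degree p)%:R * chi p x =
    (1%g \in (x ^: [set: gT])%g)%:R * (#|gT|%:R / #|(x ^: [set: gT])%g|%:R).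
  rewrite -(chi_orthogonal2 D); apply: eq_bigr => p _.
  by rewrite chi1 rmorph_nat mulrC.
split=> [p||x Xx]; first exact: ler01.
  apply: (@complexI R); rewrite rmorph_sum rmorph_nat.
  transitivity (\sum_(p : D) (degree p)%:R * chi p 1%g).
    by apply: eq_bigr => p _; rewrite mulr1 rmorphXn rmorph_nat chi1 expr2.
  by rewrite sum_deg class1G cards1 divr1 set11 mul1r.
under eq_bigr => p _ do rewrite rmorph1 mulr1.
rewrite sum_deg; have [|] := boolP (1%g \in _); last by rewrite mul0r.
rewrite class_sym class1G inE => /eqP x1.
by case: hX => /negP[]; rewrite -x1.
Qed.

(** Each complex constraint is split into its real and imaginary parts, so that
    the coefficients of the linear program are real. *)
Lemma lp_attained :
  exists2 a, lp_feasible a & forall b, lp_feasible b -> b one <= a one.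
Proof.
pose ReIm (k : {x | x \in X} * bool) (z : C) : R :=
  if k.2 then complex.Re z else complex.Im z.
pose coef k (p : D) := (degree p)%:R * ReIm k (chi p (val k.1)).
have ReImE k (a : D -> R) x :
    ReIm k (\sum_(p : D) (degree p)%:R * (a p)%:C * chi p x) =
    \sum_(p : D) (degree p)%:R * ReIm k (chi p x) * a p.
  have ReImD : {morph ReIm k : y z / y + z}.
    by rewrite /ReIm; case: k.2 => [] [? ?] [? ?].
  have ReIm0 : ReIm k 0 = 0 by rewrite /ReIm; case: k.2.
  rewrite (big_morph _ ReImD ReIm0); apply: eq_bigr => p _.
  rewrite -(rmorph_nat (real_complex R)) -rmorphM mulrAC /ReIm.
  by case: k.2; case: (chi p x) => ? ? /=; rewrite !mul0r ?subr0 ?addr0.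
have feasE a : lp_feasible a <->
    [/\ forall p, 0 <= a p, \sum_(p : D) (degree p)%:R ^+ 2 * a p = #|gT|%:R
      & forall k, \sum_p coef k p * a p = 0].
  split=> -[a_ge0 a_norm a_X]; split=> //.
    by move=> k; rewrite -ReImE a_X ?(valP k.1) // /ReIm; case: k.2.
  move=> x Xx; apply/eqP; rewrite eq_complex.
  have := a_X (exist _ x Xx, true); have := a_X (exist _ x Xx, false).
  by rewrite -!ReImE /ReIm /= => -> ->; rewrite !eqxx.
have w_gt0 (p : D) : 0 < (degree p)%:R ^+ 2 :> R.
  by rewrite exprn_gt0 // ltr0n degree_gt0.
have [|a /feasE a_feas a_max] :=
  @linear_program_max R D _ _ #|gT|%:R coef one w_gt0.
  by exists (fun=> 1); apply/feasE; exact: lp_feasible_cst1.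
by exists a => // b /feasE; exact: a_max.
Qed.

End Graph.
End ThetaCayley.

Lemma is_max_sup (R : realType) (S : set R) m : is_max S m -> sup S = m.
Proof.
move=> [Sm ubm]; apply/le_anti/andP; split.
  by apply: ge_sup => //; exists m.
by apply: sup_upper_bound => //; split; exists m.
Qed.

Local Open Scope ring_scope.
Local Open Scope complex_scope.

Theorem theorem5 (R : realType) (gT : finGroupType) (X : {set gT})
    (hX : connection_set X)
    (hconj : forall x g : gT, x \in X -> (g * x * g^-1)%g \in X)
    (D : unitary_dual R gT) (one : D) (hone : trivial_repr (irrep one)) :
  is_max (theta_values (Cay hX)) (lovasz_theta R (Cay hX)) /\
  is_max
    [set t : R | exists2 a : D -> R,
       [/\ forall p : D, 0 <= a p,
           \sum_(p : D) (degree p)%:R ^+ 2 * a p = #|gT|%:R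
         & forall x : gT, x \in X ->
             \sum_(p : D) (degree p)%:R * (a p)%:C * chi p x = 0]
     & t = a one]%classic
    (lovasz_theta R (Cay hX)).
Proof.
have [a a_feas a_max] := lp_attained hX one.
have theta_a : is_max (theta_values (Cay hX)) (a one).
  split; first exact: theta_of_lp.
  by move=> t /(lp_of_theta hconj hone)[b b_feas ->]; exact: a_max.
rewrite /lovasz_theta (is_max_sup theta_a); split=> //; split; first by exists a.
by move=> _ [b b_feas ->]; exact: a_max.
Qed.
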